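(* (i) Let $\varphi:\mathbb{K}\to[0,\infty)$ be a function with $\varphi(\hat1)=1$. There exists a unique Radon measure $\Lambda$ on $\check{\mathbb{K}}'=\check{\mathbb{K}}\setminus\{\hat1\}$ such that $\varphi(x)=\Lambda(\check{\mathbb{K}}\setminus\langle x\rangle^* )$ for all $x\in\mathbb{K}$ if and only if $\varphi$ is a completely $\vee$-alternating Scott function. (ii) Let $\Phi:\mathbb{K}\to[0,\infty)$ be a function with $\Phi(\hat1)=0$. There exists a unique Radon measure $\Lambda$ on $\mathbb{K}'=\mathbb{K}\setminus\{\hat1\}$ such that $\Phi(x)=\Lambda(\langle x\rangle^* )$ for all $x\in\mathbb{K}$ (where $\langle x\rangle^*$ is understood as $\langle x\rangle^*\cap\mathbb{K}'$) if and only if $\Phi$ is a completely $\vee$-monotone conjugate Scott function.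
   Context: A dcpo is a poset in which every (nonempty) directed subset has a supremum. In a dcpo, $x\ll y$ means that every directed $E$ with $y\le\sup E$ contains some $w$ with $x\le w$. A domain is a dcpo in which, for each $x$, the set $\{z: z\ll x\}$ is a directed lower set with supremum $x$. A subset $U$ is Scott open if it is an upper set and meets every directed $E$ with $\sup E\in U$. Write $\langle x\rangle^*=\{z: x\le z\}$. The Lawson topology has as subbase the Scott open sets together with the complements of the sets $\langle x\rangle^*$. $\mathbb{K}$ is a domain which is also a lattice with top element $\hat1$, such that $\hat1\ll\hat1$ and $\ll$ is multiplicative: $a\ll x$, $b\ll y$ imply $a\wedge b\ll x\wedge y$. $\check{\mathbb{K}}=\mathbb{K}\cup\{\hat0\}$ is obtained by adjoining a new bottom element $\hat0$ (whether or not $\mathbb{K}$ already has one); it is a continuous lattice, compact Hausdorff in its Lawson topology. $\check{\mathbb{K}}'=\check{\mathbb{K}}\setminus\{\hat1\}$ (compact Hausdorff) and $\mathbb{K}'=\mathbb{K}\setminus\{\hat1\}$ (locally compact Hausdorff) carry the Lawson topology (the subspace topology from $\check{\mathbb{K}}$). A Radon measure is a Borel measure, finite on compact sets, inner regular on open sets and outer regular on Borel sets. A Scott function is a function $\varphi:\mathbb{K}\to[0,\infty)$ with $\varphi(x)=\sup_{z\ll x}\varphi(z)$ for all $x$ (in particular increasing), normalized by $\varphi(\hat1)=1$. A conjugate Scott function is a function $\Phi:\mathbb{K}\to[0,\infty)$ with $\Phi(x)=\inf_{z\ll x}\Phi(z)$ for all $x$ (in particular decreasing, possibly unbounded), normalized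 by $\Phi(\hat1)=0$. Put $\Delta_z\phi(x)=\phi(x)-\phi(x\vee z)$ and $\Delta_{z_1,\ldots,z_n}\phi=\Delta_{z_n}(\Delta_{z_1,\ldots,z_{n-1}}\phi)$; this depends only on $A=\{z_1,\ldots,z_n\}$ and is denoted $\Delta_A\phi$. An increasing $\phi$ is completely $\vee$-alternating if $\Delta_A\phi\le0$ for every nonempty finite $A\subseteq\mathbb{K}$; a decreasing $\phi$ is completely $\vee$-monotone if $\Delta_A\phi\ge0$ for every nonempty finite $A\subseteq\mathbb{K}$. *)

(* Defs.v *)
From HB Require Import structures.
From mathcomp Require Import all_boot all_order all_algebra.
From mathcomp Require Import all_classical all_reals all_analysis.

Set Implicit Arguments.
Unset Strict Implicit.
Unset Printing Implicit Defensive.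

Import Order.TTheory GRing.Theory Num.Theory.
Local Open Scope classical_set_scope.
Local Open Scope ring_scope.

Section domains.
Context {d : Order.disp_t} {T : porderType d}.
Implicit Types (x y z : T) (E U : set T).

Definition directed E :=
  E !=set0 /\
  forall x y, E x -> E y -> exists z, [/\ E z, (x <= z)%O & (y <= z)%O].

Definition way_below x y :=
  forall E s, directed E -> supremums E s -> (y <= s)%O ->
  exists2 w, E w & (x <= w)%O.

Definition way_below_set x : set T := [set z | way_below z x].

Definition upper_set U := forall x y, (x <= y)%O -> U x -> U y.

Definition lower_set U := forall x y, (x <= y)%O -> U y -> U x.

Definition scott_open U :=
  upper_set U /\
  forall E s, directed E -> supremums E s -> U s -> E `&` U !=set0.

Definition principal_upset x : set T := [set z | (x <= z)%O].

Definition lawson_subbase : set (set T) :=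
  [set U | scott_open U] `|` [set ~` principal_upset x | x in [set: T]].

End domains.

Definition is_dcpo d (T : porderType d) :=
  forall E : set T, directed E -> supremums E !=set0.

Definition is_domain d (T : porderType d) :=
  is_dcpo T /\
  forall x : T, [/\ directed (way_below_set x), lower_set (way_below_set x)
                  & supremums (way_below_set x) x].

Definition way_below_multiplicative d (K : latticeType d) :=
  forall a b x y : K, way_below a x -> way_below b y ->
  way_below (a `&` b)%O (x `&` y)%O.

(* [None] is the new bottom element, added even if [T] already has one. *)
Definition with_bot (T : Type) := option T.

Definition with_bot_incl (T : Type) (x : T) : with_bot T := Some x.

Section with_bot_order.
Context {d : Order.disp_t} {T : porderType d}.

Definition with_bot_le (u v : with_bot T) : bool :=
  match u, v with
  | None, _ => true
  | Some x, Some y => (x <= y)%O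
  | Some _, None => false
  end.

Lemma with_bot_le_refl : reflexive with_bot_le.
Proof. by case=> //= x; exact: lexx. Qed.

Lemma with_bot_le_anti : antisymmetric with_bot_le.
Proof. by case=> [x|] [y|] //= /le_anti ->. Qed.

Lemma with_bot_le_trans : transitive with_bot_le.
Proof. by case=> [x|] [y|] [z|] //=; exact: le_trans. Qed.

HB.instance Definition _ := Choice.copy (with_bot T) (option T).
HB.instance Definition _ := Order.Le_isPOrder.Build d (with_bot T)
  with_bot_le_refl with_bot_le_anti with_bot_le_trans.
HB.instance Definition _ := isPointed.Build (with_bot T) None.

HB.instance Definition _ := isSubBaseTopological.Build (with_bot T)
  (@lawson_subbase d (with_bot T)) id.

End with_bot_order.

Section punctured.
Context {d : Order.disp_t} (K : tLatticeType d).

Definition punctured_with_bot : set (with_bot K) :=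
  ~` [set with_bot_incl \top%O].

Definition punctured : set (with_bot K) :=
  @with_bot_incl K @` ~` [set \top%O].

End punctured.

Arguments punctured_with_bot {d} K _.
Arguments punctured {d} K _.

Section radon.
Context {R : realType} {X : ptopologicalType}.

Definition borelType := g_sigma_algebraType (@open X).

Definition relatively_open (S U : set X) := exists2 V, open V & U = S `&` V.

(* A Borel measure on a Borel subspace [S] of [X] is encoded as a Borel measure
   on [X] that vanishes off [S]: the Borel sets of [S] are the Borel sets of [X]
   contained in [S], and a subset of [S] is compact in [S] iff it is compact in
   [X]. The subtype of [X] given by [S] is not used because [S] may be empty,
   while measurable types are pointed. *)
Definition radon_on (S : set X) (mu : {measure set borelType -> \bar R}) :=
  [/\ mu (~` S) = 0%E,
      (forall C, compact C -> C `<=` S -> (mu C < +oo)%E),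
      (forall U, relatively_open S U ->
         mu U = ereal_sup [set mu C | C in [set C | compact C /\ C `<=` U]])
    & (forall B : set borelType, measurable B -> B `<=` S ->
         mu B = ereal_inf
           [set mu U | U in [set U | relatively_open S U /\ B `<=` U]])].

(* Uniqueness is on Borel sets, as [mu A] is junk when [A] is not measurable. *)
Definition exists_unique_radon_on (S : set X)
    (P : {measure set borelType -> \bar R} -> Prop) :=
  exists mu : {measure set borelType -> \bar R},
    [/\ radon_on S mu, P mu
      & forall nu : {measure set borelType -> \bar R},
          radon_on S nu -> P nu ->
          forall B : set borelType, measurable B -> nu B = mu B].

End radon.

Section scott_functions.
Context {d : Order.disp_t} {K : tLatticeType d} {R : realType}.
Implicit Types (phi : K -> R) (x y z : K) (s t : seq K).

Definition scott_function phi :=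
  [/\ forall x, 0 <= phi x, phi \top%O = 1
    & forall x,
        (phi x)%:E = ereal_sup [set (phi z)%:E | z in way_below_set x]].

Definition conjugate_scott_function phi :=
  [/\ forall x, 0 <= phi x, phi \top%O = 0
    & forall x,
        (phi x)%:E = ereal_inf [set (phi z)%:E | z in way_below_set x]].

Definition join_diff z phi : K -> R := fun x => phi x - phi (x `|` z)%O.

Definition join_diffs s phi : K -> R :=
  foldl (fun psi z => join_diff z psi) phi s.

Lemma join_diffC z w phi :
  join_diff z (join_diff w phi) = join_diff w (join_diff z phi).
Proof.
by apply/funext => x; rewrite /join_diff joinAC !opprD addrACA.
Qed.

Lemma join_diff_idem z phi : join_diff z (join_diff z phi) = join_diff z phi.
Proof.
by apply/funext => x; rewrite /join_diff -joinA joinxx subrr subr0.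
Qed.

Lemma join_diffs_join_diff s z phi :
  join_diffs s (join_diff z phi) = join_diff z (join_diffs s phi).
Proof.
by elim: s phi => //= w s IHs phi; rewrite join_diffC IHs.
Qed.

Lemma mem_join_diffs s z phi :
  z \in s -> join_diff z (join_diffs s phi) = join_diffs s phi.
Proof.
elim: s phi => //= w s IHs phi; rewrite inE => /predU1P[->|]; last exact: IHs.
by rewrite join_diffs_join_diff join_diff_idem.
Qed.

Lemma join_diffs_absorb s t phi :
  {subset t <= s} -> join_diffs t (join_diffs s phi) = join_diffs s phi.
Proof.
elim: t => //= z t IHt ts; rewrite mem_join_diffs ?ts ?mem_head//.
by apply: IHt => x xt; rewrite ts// inE xt orbT.
Qed.

Lemma join_diffs_swap s t phi :
  join_diffs s (join_diffs t phi) = join_diffs t (join_diffs s phi).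
Proof.
elim: s phi => //= z s IHs phi.
by rewrite -join_diffs_join_diff IHs.
Qed.

(* Hence [join_diffs s] depends only on the finite set of elements of [s]. *)
Lemma eq_mem_join_diffs s t phi : s =i t -> join_diffs s phi = join_diffs t phi.
Proof.
move=> st; rewrite -[LHS](@join_diffs_absorb _ t); last first.
  by move=> x; rewrite st.
by rewrite join_diffs_swap join_diffs_absorb// => x; rewrite st.
Qed.

Definition completely_join_alternating phi :=
  {homo phi : x y / (x <= y)%O >-> x <= y} /\
  forall s, s != [::] -> forall x, join_diffs s phi x <= 0.

Definition completely_join_monotone phi :=
  {homo phi : x y / (x <= y)%O >-> y <= x} /\
  forall s, s != [::] -> forall x, 0 <= join_diffs s phi x.

End scott_functions.

(* Main.v *)
(* Write [up u] for the principal upset of [u]. For completely monotone [Phi]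
   and a finite set [s], nonnegativity of the differences of [Phi] yields a
   finitely supported measure giving [up z] the mass [Phi z] for all [z] in [s].
   The limit of these along an ultrafilter of finite sets is a finitely additive
   set function [m] with [m (up z) = Phi z] for every [z]. On an open subset of
   a compact Hausdorff space, a locally finite such [m] induces a Radon measure
   [L] with [m C <= L C] for compact [C] and [L U <= m U] for open [U]. Since
   [up x] lies in the Scott open set of the points way above [z] whenever
   [z << x], the conjugate Scott property gives [L (up x) = Phi x].
   Uniqueness holds because between a compact set and an open set containing it
   there is a member of the sigma-algebra generated by the principal upsets,
   which form a pi-system. Part (i) is the case [Phi = 1 - phi], with the
   missing mass placed at the new bottom element. *)
From HB Require Import structures.
Require Import Defs.
From mathcomp Require Import all_boot all_order all_algebra finmap.
From mathcomp Require Import all_classical all_reals all_analysis.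
Import Order.TTheory GRing.Theory Num.Theory.
Local Open Scope classical_set_scope.
Local Open Scope ring_scope.

Set Implicit Arguments.
Unset Strict Implicit.
Unset Printing Implicit Defensive.

(** * Tools on compactness and suprema *)

(** If there were no such [U], the sets containing some [C \ U] with [U] open and [P U] would form a
    proper filter. A cluster point in [C] has an open neighbourhood [W] with [P W], yet [C \ W]
    belongs to the filter. *)
Lemma compact_open_ind (T : topologicalType) (C : set T) (P : set T -> Prop) :
  compact C -> P set0 -> (forall A B, P A -> P B -> P (A `|` B)) ->
  (forall x, C x -> exists W, [/\ open W, W x & P W]) ->
  exists U, [/\ open U, C `<=` U & P U].
Proof.
move=> cC P0 PU Ploc; apply: contrapT => /forallNP nU.
pose F : set_system T :=
  [set A | exists U, [/\ open U, P U & C `\` U `<=` A]].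
have FC : F C by exists set0; split; [exact: open0|exact: P0|exact: subDsetl].
have FF : ProperFilter F.
  apply: Build_ProperFilter_ex.
    move=> A [U [oU PUU UA]]; apply: contrapT => /forallNP nA.
    apply: (nU U); split => // x Cx; apply: contrapT => nUx.
    by apply: (nA x); exact: UA.
  split; first by exists set0; split => //; exact: open0.
    move=> A B [U [oU PUU UA]] [V [oV PV VB]]; exists (U `|` V).
    split; [exact: openU|exact: PU|move=> x [Cx /not_orP[nUx nVx]]].
    by split; [exact: UA|exact: VB].
  by move=> A B AB [U [oU PUU UA]]; exists U; split => // x /UA /AB.
have [p [Cp clp]] := cC F FF FC.
have [W [oW Wp PW]] := Ploc _ Cp.
have FW : F (C `\` W) by exists W; split.
have [|y [[_ nWy] Wy]] := clp _ W FW; last exact: nWy.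
exact: open_nbhs_nbhs.
Qed.

(** Membership of 0 gives [c <= t], so outside the trivial cases [c] is finite and can be moved
    across. *)
Lemma ereal_sup_addr_le (R : realType) (A : set (\bar R)) (c t : \bar R) :
  A 0%E -> (forall x, A x -> (x + c <= t)%E) -> (ereal_sup A + c <= t)%E.
Proof.
move=> A0 Act; have [->|tNy] := eqVneq t +oo%E; first exact: leey.
have [->|cNy] := eqVneq c -oo%E; first by rewrite addeNy leNye.
have cfin : c \is a fin_num.
  rewrite fin_numE cNy /= -ltey (@le_lt_trans _ _ t) ?ltey//.
  by rewrite -[c]add0e; exact: Act.
rewrite -leeBrDr//; apply: ge_ereal_sup => x Ax.
by rewrite leeBrDr//; exact: Act.
Qed.

(** * Radon measures from finitely additive set functions *)

Section radon_of_content.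
Context {R : realType} {X : ptopologicalType}.
Hypotheses (hX : hausdorff_space X) (cX : compact [set: X]).
Variable S : set X.
Hypothesis oS : open S.
Variable m : set X -> \bar R.
Hypothesis m0 : m set0 = 0%E.
Hypothesis m_ge0 : forall A, (0 <= m A)%E.
Hypothesis mU :
  forall A B, A `&` B = set0 -> m (A `|` B) = (m A + m B)%E.

(** Regularity of a compact Hausdorff space gives this at each point of [C], and closure commutes
    with finite unions. *)
Lemma compact_shrink (C U : set X) : compact C -> open U -> C `<=` U ->
  exists V, [/\ open V, C `<=` V & closure V `<=` U].
Proof.
move=> cC oU CU.
apply: (@compact_open_ind _ C (fun V => closure V `<=` U)) => //.
- by rewrite closure0.
- by move=> A B AU BU; rewrite closureU subUset.
- move=> x Cx.
  have [] := @compact_regular X x setT hX cX filterT U.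
    by apply: open_nbhs_nbhs; split => //; exact: CU.
  move=> A; rewrite nbhsE => -[W [oW Wx] WA] AU; exists W; split => //.
  exact/(subset_trans _ AU)/closure_subset.
Qed.

Let le_m A B : A `<=` B -> (m A <= m B)%E.
Proof.
move=> AB; rewrite -(setDUK AB) mU ?leeDl//.
by rewrite setDE setIA setIC setIA setICl set0I.
Qed.

Let leU_m A B : (m (A `|` B) <= m A + m B)%E.
Proof.
rewrite -(setDUK (@subsetUl _ A B)) mU; last by rewrite setDIK.
by apply: leeD2l; apply: le_m => x [[]].
Qed.

(* Inner regularization of [m] on open sets: [m] itself need not be countably
   subadditive, but compactness of [closure V] makes this one so. *)
Definition inner_content (U : set X) : \bar R :=
  ereal_sup [set m V | V in [set V | open V /\ closure V `<=` U `&` S]].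

Let h := inner_content.

(** Only the part of [A] in [S] counts, which makes the complement of [S] null. *)
Definition radon_outer (A : set X) : \bar R :=
  ereal_inf [set h U | U in [set U | open U /\ A `&` S `<=` U]].

Let mu := radon_outer.

Let h_ub U V : open V -> closure V `<=` U `&` S -> (m V <= h U)%E.
Proof. by move=> oV VU; apply: ereal_sup_ubound; exists V. Qed.

Let h_ge0 U : (0 <= h U)%E.
Proof. by rewrite -m0; apply: h_ub; [exact: open0|rewrite closure0]. Qed.

Let h0 : h set0 = 0%E.
Proof.
apply/eqP; rewrite eq_le h_ge0 andbT; apply: ge_ereal_sup => _ [V [_ +] <-].
rewrite set0I => /(subset_trans (@subset_closure _ V)).
by rewrite subset0 => ->; rewrite m0.
Qed.

Let le_h U V : U `&` S `<=` V -> (h U <= h V)%E.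
Proof.
move=> UV; apply: ge_ereal_sup => _ [W [oW WU] <-]; apply: h_ub => // x /WU.
by move=> Ux; split; [exact: UV|case: Ux].
Qed.

(** Since [closure V] is compact, [V] is covered by finitely many open [v n], each with closure
    inside both [U n] and [S]; finite subadditivity of [m] then suffices. *)
Let h_sigma_subadditive (U : (set X)^nat) : (forall n, open (U n)) ->
  (h (\bigcup_n U n) <= \sum_(n <oo) h (U n))%E.
Proof.
move=> oU; apply: ge_ereal_sup => _ [V [oV VU] <-].
pose P (W : set X) := exists (N : nat) (v : (set X)^nat),
  (forall n, open (v n) /\ closure (v n) `<=` U n `&` S) /\
  W `<=` \bigcup_(n in `I_N) v n.
have [W [_ VW [N [v [vU Wv]]]]] : exists W, [/\ open W, closure V `<=` W & P W].
  apply: compact_open_ind.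
  - by apply: (subclosed_compact _ cX) => //; exact: closed_closure.
  - exists 0%N, (fun=> set0); split => // n; split; first exact: open0.
    by rewrite closure0.
  - move=> A B [N [v [vU Av]]] [M [w [wU Bw]]].
    exists (maxn N M), (fun n => v n `|` w n); split.
      move=> n; split; first by apply: openU; [case: (vU n)|case: (wU n)].
      rewrite closureU subUset; split; [exact: (vU n).2|exact: (wU n).2].
    move=> x [/Av|/Bw] [i /= ilt ?].
      by exists i => /=; [rewrite leq_max ilt|left].
    by exists i => /=; [rewrite leq_max ilt orbT|right].
  - move=> x /VU[[n _ Unx] Sx].
    have [] := @compact_shrink [set x] (U n `&` S).
    + exact: compact_set1.
    + exact: openI.
    + by move=> _ ->.
    move=> A [oA xA AU]; exists A; split => //; first exact: xA.
    exists n.+1, (fun k => if k == n then A else set0); split.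
      move=> k; case: eqP => [->|_]; first by split.
      by split; [exact: open0|rewrite closure0].
    move=> y Ay; exists n => //=.
    by rewrite eqxx.
apply: (@le_trans _ _ (\sum_(0 <= n < N) h (U n))%E); last first.
  exact: nneseries_lim_ge.
apply: (@le_trans _ _ (m (\big[setU/set0]_(n < N) v n))).
  rewrite -bigcup_mkord; apply: le_m => x Vx; apply: Wv; apply: VW;
    exact: subset_closure.
rewrite big_mkord; elim: N {Wv} => [|N IH]; first by rewrite !big_ord0 m0.
rewrite !big_ord_recr /=; apply: (le_trans (leU_m _ _)).
by apply: leeD => //; apply: h_ub; case: (vU N).
Qed.

Let mu_open U : open U -> mu U = h U.
Proof.
move=> oU; apply/eqP; rewrite eq_le; apply/andP; split.
  by apply: ereal_inf_lbound; exists U => //; split => // x [].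
by apply: le_ereal_inf_tmp => _ [V [_ UV] <-]; exact: le_h.
Qed.

Let mu0 : mu set0 = 0%E.
Proof. by rewrite mu_open ?h0//; exact: open0. Qed.

Let mu_ge0 A : (0 <= mu A)%E.
Proof. by apply: le_ereal_inf_tmp => _ [V _ <-]. Qed.

Let le_muS A B : A `&` S `<=` B -> (mu A <= mu B)%E.
Proof.
move=> AB; apply: le_ereal_inf_tmp => _ [V [oV BV] <-].
by apply: ereal_inf_lbound; exists V => //; split => // x [Ax Sx];
  apply: BV; split => //; exact: AB.
Qed.

Let le_mu : {homo mu : A B / A `<=` B >-> (A <= B)%E}.
Proof. by move=> A B AB; apply: le_muS => x [/AB]. Qed.

Let mu_sigma_subadditive : sigma_subadditive mu.
Proof.
move=> A; have [[i ioo]|] := pselect (exists i, mu (A i) = +oo%E).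
  rewrite (eseries_pinfty _ _ ioo) ?leey// => n _.
  by rewrite -ltNye (lt_le_trans _ (mu_ge0 _)).
rewrite -forallNE => Aoo.
apply/lee_addgt0Pr => e e0.
rewrite (le_trans _ (epsilon_trick _ _ (ltW e0)))//.
pose P n (U : set X) := (open U /\ A n `&` S `<=` U) /\
  (h U <= mu (A n) + (e / (2 ^ n.+1)%:R)%:E)%E.
have [G PG] : {G : (set X)^nat & forall n, P n (G n)}.
  apply: (@choice _ _ P) => n.
  have en1 : (0 < e / (2 ^ n.+1)%:R)%R by rewrite divr_gt0.
  have fmu : mu (A n) \is a fin_num.
    rewrite ge0_fin_numE// ltey; exact/eqP.
  have [_ [U UA <-] hU] := lb_ereal_inf_adherent en1 fmu.
  by exists U; split => //; exact: ltW.
apply: (@le_trans _ _ (mu (\bigcup_n G n))).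
  apply: le_muS => x [[n _ Anx] Sx]; exists n => //.
  by apply: (PG n).1.2.
rewrite mu_open; last by apply: bigcup_open => n _; exact: (PG n).1.1.
apply: (le_trans (h_sigma_subadditive _)).
  by move=> n; exact: (PG n).1.1.
by apply: lee_nneseries => // n _; exact: (PG n).2.
Qed.

HB.instance Definition _ := isOuterMeasure.Build R X mu
  mu0 mu_ge0 le_mu mu_sigma_subadditive.

(** Given an open [Q] covering the part of [A] in [S], exhaust [Q] inside [U] by some [V], then the
    open set [Q \ closure V], which contains [Q \ U], by some [W]. As [V] and [W] are disjoint,
    [m V + m W] is at most [h Q]. *)
Let open_caratheodory U : open U -> caratheodory_measurable mu U.
Proof.
move=> oU; apply: le_caratheodory_measurable => A /=.
apply: le_ereal_inf_tmp => _ [Q [oQ AQ] <-].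
apply: (@le_trans _ _ (h (Q `&` U) + mu (Q `\` U))%E).
  apply: leeD.
    rewrite -mu_open; last exact: openI.
    by apply: le_muS => x [[Ax Ux] Sx]; split => //; apply: AQ.
  by apply: le_muS => x [[Ax Ux] Sx]; split => //; apply: AQ.
apply: ereal_sup_addr_le => /= [|_ [V [oV VQU] <-]].
  by exists set0 => //; split; [exact: open0|rewrite closure0].
have oW : open (Q `\` closure V).
  by apply: openI => //; apply: closed_openC; exact: closed_closure.
apply: (@le_trans _ _ (m V + h (Q `\` closure V))%E).
  apply: leeD2l; rewrite -mu_open//; apply: le_mu => x [Qx nUx]; split => //.
  by move=> /VQU[[]].
rewrite addeC; apply: ereal_sup_addr_le => //.
  by exists set0 => //; split; [exact: open0|rewrite closure0].
move=> _ [W [oV' WV] <-]; rewrite addeC -mU.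
  apply: h_ub; first exact: openU.
  rewrite closureU subUset; split => x; first by move=> /VQU[[]].
  by move=> /WV[[]].
rewrite -subset0 => x [/subset_closure Vx] /subset_closure/WV[[_ nVx] _].
exact: nVx.
Qed.

Let borel_caratheodory (A : set (@borelType X)) :
  measurable A -> caratheodory_measurable mu A.
Proof.
move: A; apply: smallest_sub; last by move=> A; exact: open_caratheodory.
split.
- exact: caratheodory_measurable_set0.
- move=> A cA; rewrite setTD; exact: caratheodory_measurable_setC.
- exact: caratheodory_measurable_bigcup.
Qed.

Let mu_sigma_additive : semi_sigma_additive (mu : set (@borelType X) -> _).
Proof.
move=> A mA tA mbigcupA.
apply: (@caratheodory_measure_sigma_additive R X mu) => //.
- by move=> n; exact: borel_caratheodory.
- exact: borel_caratheodory.
Qed.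

(** A separate name, so that the outer measure structure on [X] and the measure structure on its
    Borel sets can coexist. *)
Let bmu : set (@borelType X) -> \bar R := mu.

HB.instance Definition _ := isMeasure.Build _ (@borelType X) R bmu
  mu0 mu_ge0 mu_sigma_additive.

Hypothesis m_locfin :
  forall x, S x -> exists W, [/\ open W, W x & (m W < +oo)%E].

Let mu_le_m U : open U -> (mu U <= m U)%E.
Proof.
move=> oU; rewrite mu_open//; apply: ge_ereal_sup => _ [V [_ VU] <-].
by apply: le_m => x /subset_closure/VU[].
Qed.

Let m_le_mu C : compact C -> C `<=` S -> (m C <= mu C)%E.
Proof.
move=> cC CS; apply: le_ereal_inf_tmp => _ [U [oU CU] <-].
have [|x Cx|V [oV CV VU]] := @compact_shrink C (U `&` S) cC.
- exact: openI.
- by split; [apply: CU; split => //|]; exact: CS.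
- by rewrite (le_trans (le_m CV))//; exact: h_ub.
Qed.

Lemma radon_of_content : exists L : {measure set (@borelType X) -> \bar R},
  [/\ radon_on S L,
      forall C, compact C -> C `<=` S -> (m C <= L C)%E
    & forall U, open U -> (L U <= m U)%E].
Proof.
exists bmu; split => //; split.
- apply/eqP; rewrite eq_le mu_ge0 andbT -[leRHS]mu0; apply: le_muS.
  by rewrite setICl.
- move=> C cC CS.
  have [U [oU CU mUoo]] : exists U, [/\ open U, C `<=` U & (m U < +oo)%E].
    apply: compact_open_ind => //; first by rewrite m0.
    - by move=> A B Ay By; apply: (le_lt_trans (leU_m A B));
        exact: lte_add_pinfty.
    - by move=> x /CS /m_locfin.
  exact: le_lt_trans (le_mu CU) (le_lt_trans (mu_le_m oU) mUoo).
- move=> _ [V oV ->]; have oSV : open (S `&` V) by exact: openI.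
  apply/eqP; rewrite eq_le; apply/andP; split; last first.
    by apply: ge_ereal_sup => _ [C [_ CSV] <-]; exact: le_mu.
  (* Inner regularity: [closure W] is a compact subset of the given open set and has mass at least
     [m W]. *)
  rewrite [leLHS]mu_open//; apply: ge_ereal_sup => _ [W [oW WSV] <-].
  have cW : compact (closure W).
    by apply: (subclosed_compact _ cX) => //; exact: closed_closure.
  apply: (@le_trans _ _ (mu (closure W))).
    apply: (@le_trans _ _ (m (closure W))).
      by apply: le_m; exact: subset_closure.
    by apply: m_le_mu => // x /WSV[[]].
  apply: ereal_sup_ubound; exists (closure W) => //; split => //.
  by move=> x /WSV[].
- move=> B _ BS; apply/eqP; rewrite eq_le; apply/andP; split.
    by apply: le_ereal_inf_tmp => _ [U [_ BU] <-]; exact: le_mu.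
  apply: le_ereal_inf_tmp => _ [U [oU BU] <-].
  apply: (@le_trans _ _ (mu (S `&` U))).
    apply: ereal_inf_lbound; exists (S `&` U) => //; split; first by exists U.
    by move=> x Bx; split; [exact: BS|apply: BU; split => //; exact: BS].
  by rewrite -mu_open//; apply: le_mu.
Qed.

End radon_of_content.

(** * Borel sets of a topological space *)

Section borel_theory.
Context {R : realType} {X : ptopologicalType}.
Implicit Types (A B U : set (@borelType X))
  (N : {measure set (@borelType X) -> \bar R}).

Lemma borel_open U : open (U : set X) -> measurable U.
Proof. exact: sub_sigma_algebra. Qed.

Lemma borel_closed U : closed (U : set X) -> measurable U.
Proof.
by move=> cU; rewrite -[U]setCK; apply: measurableC; apply: borel_open;
  exact: closed_openC.
Qed.

Lemma le_borel_measure N A B :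
  measurable A -> measurable B -> A `<=` B -> (N A <= N B)%E.
Proof. by move=> mA mB; apply: le_measure; rewrite inE. Qed.

Lemma radon_setI (S : set X) N B : measurable (S : set (@borelType X)) ->
  measurable B -> radon_on S N -> N B = N (B `&` S).
Proof.
move=> mS mB [N0 _ _ _]; rewrite (measureDI N mB mS).
rewrite [X in (X + _)%E](_ : _ = 0%E) ?add0e//.
apply/eqP; rewrite eq_le measure_ge0 andbT -N0 le_measure ?inE//.
- exact: measurableD.
- exact: measurableC.
Qed.

End borel_theory.

(** * The Lawson topology *)

Section way_below_theory.
Context {d : Order.disp_t} {T : porderType d}.
Implicit Types x y z : T.

Lemma way_below_le x y z : way_below x y -> (y <= z)%O -> way_below x z.
Proof.
by move=> xy yz E s dE Es zs; apply: xy Es _ => //; exact: le_trans zs.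
Qed.

Lemma le_way_below x y z : (x <= y)%O -> way_below y z -> way_below x z.
Proof.
move=> xy yz E s dE Es zs; have [w Ew yw] := yz _ _ dE Es zs.
by exists w => //; exact: le_trans yw.
Qed.

Lemma way_belowW x y : way_below x y -> (x <= y)%O.
Proof.
move=> /(_ [set y] y); case=> [||//|w ->//].
- split; first by exists y.
  by move=> _ _ -> ->; exists y.
- split; first by move=> _ ->.
  by move=> z; apply.
Qed.

Hypothesis domT : is_domain T.

Lemma exists_way_below x : exists z, way_below z x.
Proof. by have [[]] := domT.2 x. Qed.

Lemma way_below_directed x y z : way_below y x -> way_below z x ->
  exists w, [/\ way_below w x, (y <= w)%O & (z <= w)%O].
Proof. by have [[_ +] _ _] := domT.2 x; apply. Qed.

(** As [x] is the least upper bound of the elements way below it, [y] cannot bound all of them. *)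
Lemma not_le_way_below x y : ~~ (x <= y)%O ->
  exists2 z, way_below z x & ~~ (z <= y)%O.
Proof.
move=> nxy; apply: contrapT => /forall2NP h.
suff : (x <= y)%O by rewrite (negbTE nxy).
have [_ _ [_]] := domT.2 x; apply => z zx.
by have [//|/negP] := h z; rewrite negbK.
Qed.

(** The elements way below some [w << y] form a directed set with supremum [y], so [x << y] puts [x]
    below one of them. *)
Lemma way_below_interpolate x y : way_below x y ->
  exists2 w, way_below x w & way_below w y.
Proof.
move=> xy; pose E := [set u | exists2 w, way_below u w & way_below w y].
have [u [w uw wy] xu] : exists2 u, E u & (x <= u)%O.
  apply: xy (lexx y).
    split.
      have [w wy] := exists_way_below y; have [u uw] := exists_way_below w.
      by exists u, w.
    move=> u v [w uw wy] [w' vw' w'y].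
    have [w2 [w2y ww2 w'w2]] := way_below_directed wy w'y.
    have [t [tw2 ut vt]] :=
      way_below_directed (way_below_le uw ww2) (way_below_le vw' w'w2).
    by exists t; split => //; exists w2.
  split.
    by move=> u [w /way_belowW uw /way_belowW]; exact: le_trans.
  move=> b Eb; have [_ _ [_]] := domT.2 y; apply => w wy.
  have [_ _ [_]] := domT.2 w; apply => u uw.
  by apply: Eb; exists w.
by exists w => //; exact: le_way_below xu uw.
Qed.

End way_below_theory.

Section lawson.
Context {d : Order.disp_t} {K : tLatticeType d}.
Hypothesis domK : is_domain K.
Let X := with_bot K.
Implicit Types (u v : X) (x y z : K) (E U : set X).

Definition with_bot_join u v : X :=
  match u, v with
  | None, _ => v
  | _, None => u
  | Some x, Some y => Some (x `|` y)%O
  end.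

Lemma principal_upset_join u v :
  principal_upset (with_bot_join u v) = principal_upset u `&` principal_upset v.
Proof.
rewrite predeqE => -[z|]; case: u => [x|]; case: v => [y|];
  rewrite /principal_upset /= /Order.le /= ?leUx; split => //; try by case.
- by move/andP.
- by move=> [-> ->].
Qed.

Lemma principal_upset_None : principal_upset (None : X) = setT.
Proof. by apply/seteqP; split => // -[]. Qed.

Lemma with_bot_dcpo : is_dcpo X.
Proof.
move=> E dE; pose D := [set x | E (Some x)].
have [D0|D0] := pselect (D !=set0); last first.
  exists None; split; last by case.
  by move=> [x|] Ex //; exfalso; apply: D0; exists x.
have [s [Ds sD]] : supremums D !=set0.
  apply: domK.1; split => // x y Dx Dy.
  have [[z|] [Ez xz yz]] := dE.2 _ _ Dx Dy; last by [].
  by exists z.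
exists (Some s); split.
  by move=> [x|] Ex //; exact: Ds.
move=> [y|] Ey.
  by apply: sD => x Dx; exact: (Ey (Some x)).
by have [x /Ey] := D0.
Qed.

Definition way_above z : set X :=
  [set u | if u is Some x then way_below z x else False].

(** Interpolate [z << w << s]: some member of [E] lies above [w], and [z] is way below that
    member. *)
Lemma way_above_scott_open z : scott_open (way_above z).
Proof.
split.
  move=> [x|] [y|] //= xy zx; exact: way_below_le zx xy.
move=> E [s|//] dE [Es sE] /= /(way_below_interpolate domK)[w zw ws].
pose D := [set x | E (Some x)].
have D0 : D !=set0.
  apply: contrapT => D0; suff : ((Some s : X) <= (None : X))%O by [].
  by apply: sE => -[x|] Ex //; exfalso; apply: D0; exists x.
have [||//|x Dx wx] := ws D s.
- split => // x y Dx Dy.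
  have [[t|] [Et xt yt]] := dE.2 _ _ Dx Dy; last by [].
  by exists t.
- split; first by move=> x /Es.
  by move=> y Dy; apply: (sE (Some y)) => -[x|] Ex //; exact: Dy.
by exists (Some x); split => //=; exact: way_below_le wx.
Qed.

Lemma lawson_subbase_open U : lawson_subbase U -> open U.
Proof.
move=> LU; exists [set U]; last by rewrite bigcup_set1.
move=> _ ->; exists [fset U]%fset.
  by move=> V; rewrite !inE => ->.
apply/seteqP; split => t /=; first by apply; rewrite /= inE.
by move=> Ut V; rewrite /= inE => /eqP ->.
Qed.

Lemma scott_open_open U : scott_open U -> open U.
Proof. by move=> sU; apply: lawson_subbase_open; left. Qed.

Lemma open_not_principal_upset u : open (~` principal_upset u : set X).
Proof. by apply: lawson_subbase_open; right; exists u. Qed.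

Lemma principal_upset_closed u : closed (principal_upset u : set X).
Proof. by rewrite -openC; exact: open_not_principal_upset. Qed.

Lemma open_way_above z : open (way_above z).
Proof. exact/scott_open_open/way_above_scott_open. Qed.

(** A neighbourhood of [u] contains a finite intersection of subbasic sets around [u]. *)
Lemma lawson_cvg (F : set_system X) u : Filter F ->
  (forall U, lawson_subbase U -> U u -> F U) -> F --> u.
Proof.
move=> FF FU A; rewrite /= nbhsE => -[_ [[B sB <-] [C BC Ct]] sUBA].
rewrite nbhs_filterE; apply: filterS sUBA _; apply: (@filterS _ _ _ C).
  by move=> ? ?; exists C.
have /sB [D sD IDeC] := BC; rewrite -IDeC; apply: filter_bigI => V DV.
have /sD := DV; rewrite inE => LV; apply: FU => //.
by move: Ct; rewrite -IDeC => /(_ _ DV).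
Qed.

(* An ultrafilter [F] converges to the supremum of the [u] with
   [principal_upset u] in [F]. *)
Lemma lawson_compact : compact [set: X].
Proof.
rewrite compact_ultra => F UF _.
pose D := [set u | F (principal_upset u)].
have dD : directed D.
  split.
    by exists None; rewrite /D /= principal_upset_None; exact: filterT.
  move=> u v Du Dv; exists (with_bot_join u v).
  have Duv : D (with_bot_join u v).
    by rewrite /D /= principal_upset_join; exact: filterI.
  have : principal_upset (with_bot_join u v) (with_bot_join u v) by exact: lexx.
  by rewrite principal_upset_join => -[].
have [s [Ds sD]] := with_bot_dcpo dD.
exists s; split => //; apply: lawson_cvg => U [sU|[u _ <-]].
  move=> Us; have [w [Dw Uw]] := sU.2 _ _ dD (conj Ds sD) Us.
  by apply: filterS Dw => v wv; exact: sU.1 wv Uw.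
move=> nus; have [Fu|//] := in_ultra_setVsetC (principal_upset u) UF.
by exfalso; apply: nus; exact: Ds.
Qed.

Lemma not_le_separated u v : ~~ (u <= v)%O ->
  exists z, way_above z u /\ ~ principal_upset (Some z : X) v.
Proof.
case: u v => [x|] [y|] //= nuv; last first.
  by have [z zx] := exists_way_below domK x; exists z.
have [z zx nzy] := not_le_way_below domK nuv; exists z; split => //.
exact/negP.
Qed.

Lemma way_above_sub z : way_above z `<=` principal_upset (Some z : X).
Proof. by case=> // x /way_belowW. Qed.

(** When [u <= v] fails, some [z] is way below [u] and not below [v]; then [way_above z] and the
    complement of [up z] separate the two points. *)
Lemma lawson_hausdorff : hausdorff_space X.
Proof.
rewrite open_hausdorff => u v uv.
wlog nuv : u v uv / ~~ (u <= v)%O.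
  move=> H; have [vu|] := boolP (u <= v)%O; last exact: H.
  have nvu : ~~ (v <= u)%O by apply: contra uv => vu'; rewrite eq_le vu vu'.
  have vNu : v != u by rewrite eq_sym.
  have [[A B] [vA uB] [oA oB AB]] := H v u vNu nvu.
  by exists (B, A) => //; rewrite setIC.
have [z [zu nzv]] := not_le_separated nuv.
exists (way_above z, ~` principal_upset (Some z : X)).
  by rewrite !inE.
split => /=; [exact: open_way_above|exact: open_not_principal_upset|].
apply/eqP; rewrite -subset0 => w [/way_above_sub]; exact.
Qed.

End lawson.

(** * Finitely additive set functions from completely monotone functions *)

Section ultralimit.
Context {I : Type} {R : realType}.
Variable U : set_system I.
Hypothesis UU : UltraFilter U.
Implicit Types f g : I -> \bar R.

(** Written as a limit inferior, which along an ultrafilter is the limit and always exists in the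
    extended reals. *)
Definition ultralim f : \bar R := ereal_sup [set c | U [set i | (c <= f i)%E]].

Lemma ultralim_ge0 f : (forall i, (0 <= f i)%E) -> (0 <= ultralim f)%E.
Proof.
move=> f0; apply: ereal_sup_ubound => /=; apply: filterS filterT => i _ /=.
exact: f0.
Qed.

Lemma ultralim_cst c f : U [set i | f i = c] -> ultralim f = c.
Proof.
move=> fc; apply/eqP; rewrite eq_le; apply/andP; split.
  apply: ge_ereal_sup => b /= Ub.
  by have [i /= [<-]] := filter_ex (filterI fc Ub).
by apply: ereal_sup_ubound; apply: filterS fc => i /= ->.
Qed.

Lemma ultralimD f g : (forall i, (0 <= f i)%E) -> (forall i, (0 <= g i)%E) ->
  ultralim (fun i => (f i + g i)%E) = (ultralim f + ultralim g)%E.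
Proof.
move=> f0 g0.
have U0 h : (forall i, (0 <= h i)%E) -> U [set i | (0 <= h i)%E].
  by move=> h0; apply: filterS filterT => i _ /=; exact: h0.
apply/eqP; rewrite eq_le; apply/andP; split; last first.
  apply: ereal_sup_addr_le => [|c Uc]; first exact: U0.
  rewrite addeC; apply: ereal_sup_addr_le => [|b Ub]; first exact: U0.
  rewrite addeC; apply: ereal_sup_ubound.
  apply: filterS (filterI Uc Ub) => i [].
  exact: leeD.
have [->|foo] := eqVneq (ultralim f) +oo%E.
  by rewrite addye ?leey// gt_eqF// (lt_le_trans _ (ultralim_ge0 g0)).
have [->|goo] := eqVneq (ultralim g) +oo%E.
  by rewrite addey ?leey// gt_eqF// (lt_le_trans _ (ultralim_ge0 f0)).
have ffin : ultralim f \is a fin_num.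
  by rewrite ge0_fin_numE ?ultralim_ge0 ?ltey.
have gfin : ultralim g \is a fin_num.
  by rewrite ge0_fin_numE ?ultralim_ge0 ?ltey.
(* Eventual lower bounds add up along any filter. The reverse inequality rests on the ultrafilter
   dichotomy: otherwise [ultralim h + e] would be an eventual lower bound of [h]. *)
have near h : ultralim h \is a fin_num -> forall e : R, 0 < e ->
    U [set i | (h i < ultralim h + e%:E)%E].
  move=> hfin e e0.
  have [Ule|] := in_ultra_setVsetC [set i | (ultralim h + e%:E <= h i)%E] UU.
    suff : (ultralim h + e%:E <= ultralim h)%E.
      by rewrite leNgt lteDl// lte_fin e0.
    exact: ereal_sup_ubound.
  by apply: filterS => i /negP /=; rewrite -ltNge.
apply/lee_addgt0Pr => e e0; apply: ge_ereal_sup => c /= Uc.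
have e2 : 0 < e / 2 by rewrite divr_gt0.
have [i /= [ci [fi gi]]] :=
  filter_ex (filterI Uc (filterI (near f ffin _ e2) (near g gfin _ e2))).
apply: (le_trans ci); apply: (le_trans (leeD (ltW fi) (ltW gi))).
by rewrite addeACA -EFinD -splitr.
Qed.

End ultralimit.

Section discrete_content.
Context {d : Order.disp_t} {K : tLatticeType d} {R : realType}.
Let X := with_bot K.
Implicit Types (P : K -> R) (x z w : K) (s : seq K) (A B : set X).

(* The sum over [B <= s] of the differences of [P] along [s \ B], taken at the
   join of [x] and [B], times the Dirac mass at that join. *)
Fixpoint discrete_content s P x A : R :=
  if s is z :: s' then
    discrete_content s' (join_diff z P) x A +
    discrete_content s' P (x `|` z)%O A
  else P x * \1_A (Some x).

Lemma discrete_content_ge0 s P x A : (forall t y, 0 <= join_diffs t P y) ->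
  0 <= discrete_content s P x A.
Proof.
elim: s P x => [|z s IH] P x P0 /=.
  by apply: mulr_ge0; [exact: (P0 [::])|rewrite indicE; case: (_ \in _)].
apply: addr_ge0; last exact: IH.
by apply: IH => t y; exact: (P0 (z :: t)).
Qed.

Lemma discrete_content0 s P x : discrete_content s P x set0 = 0.
Proof.
by elim: s P x => [|z s IH] P x /=; rewrite ?indic0 ?mulr0// !IH addr0.
Qed.

Lemma discrete_contentU s P x A B : A `&` B = set0 ->
  discrete_content s P x (A `|` B) =
  discrete_content s P x A + discrete_content s P x B.
Proof.
move=> AB; elim: s P x => [|z s IH] P x /=; last by rewrite !IH addrACA.
rewrite -mulrDr; congr (_ * _); rewrite !indicE in_setU.
have : ~ (A `&` B) (Some x) by rewrite AB.
have [|_] := boolP (Some x \in A); have [|_] := boolP (Some x \in B);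
  rewrite ?inE ?addr0 ?add0r//.
by move=> Bx Ax; case.
Qed.

Lemma discrete_contentT s P x : discrete_content s P x setT = P x.
Proof.
elim: s P x => [|z s IH] P x /=; first by rewrite indicT mulr1.
by rewrite !IH /join_diff subrK.
Qed.

(** An atom at a point above [w] has as weight a difference of [P] taken at that point, which only
    involves values of [P] above [w]. *)
Lemma discrete_content_vanish s P x w :
  (forall y, (w <= y)%O -> P y = 0) ->
  discrete_content s P x (principal_upset (Some w : X)) = 0.
Proof.
elim: s P x => [|z s IH] P x P0 /=.
  rewrite indicE; have [|_] := boolP (_ \in _); last by rewrite mulr0.
  by rewrite inE => /P0 ->; rewrite mul0r.
rewrite !IH ?addr0// => y wy; rewrite /join_diff !P0 ?subrr//.
exact: lexUl.
Qed.

(** All atoms lie above [x], hence in [up w], so this is the total mass. *)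
Lemma discrete_content_full s P x w : (w <= x)%O ->
  discrete_content s P x (principal_upset (Some w : X)) = P x.
Proof.
elim: s P x => [|z s IH] P x wx /=.
  by rewrite indicE mem_set ?mulr1.
by rewrite !IH ?lexUl// /join_diff subrK.
Qed.

(** At the entry [w] of [s], the branch that omits [w] carries a difference along [w], which
    vanishes above [w]; the branch that joins [w] lies entirely in [up w]. *)
Lemma discrete_content_upset s P x w : w \in s ->
  discrete_content s P x (principal_upset (Some w : X)) = P (x `|` w)%O.
Proof.
elim: s P x => //= z s IH P x; rewrite inE => /predU1P[->|ws].
  rewrite discrete_content_vanish ?add0r.
    by rewrite discrete_content_full// lexUr.
  by move=> y zy; rewrite /join_diff (join_l zy) subrr.
by rewrite !IH// /join_diff joinAC subrK.
Qed.

(** The set function is a limit of discrete contents over finite lists [s], with an additional mass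
    [c s] at the new bottom. That mass is seen by the whole space but by no [up x] with [x] in
    [K]. *)
Lemma exists_content P (c : seq K -> R) :
  (forall t y, 0 <= join_diffs t P y) -> (forall s, 0 <= c s) ->
  exists m : set X -> \bar R,
    [/\ m set0 = 0%E, (forall A, 0 <= m A)%E,
        (forall A B, A `&` B = set0 -> m (A `|` B) = (m A + m B)%E),
        (forall x, m (principal_upset (Some x : X)) = (P x)%:E)
      & forall k, (forall s, P (\meet_(z <- s) z)%O + c s = k) ->
          m setT = k%:E].
Proof.
move=> P0 c0.
(* Along this filter, every given element of [K] eventually belongs to [s]. *)
pose F : set_system (seq K) :=
  [set Q | exists s0, forall s, {subset s0 <= s} -> Q s].
have FF : ProperFilter F.
  apply: Build_ProperFilter_ex.
    by move=> Q [s0 Qs]; exists s0; exact: Qs.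
  split; first by exists [::].
    move=> Q Q' [s Qs] [s' Qs']; exists (s ++ s') => t st; split.
      by apply: Qs => x xs; apply: st; rewrite mem_cat xs.
    by apply: Qs' => x xs; apply: st; rewrite mem_cat xs orbT.
  by move=> Q Q' QQ' [s Qs]; exists s => t /Qs /QQ'.
have [U [UU FU]] := ultraFilterLemma FF.
(* Starting below every entry makes [base s] joined with an entry [x] equal to [x], so [up x]
   receives exactly [P x]. *)
pose base s := (\meet_(z <- s) z)%O.
pose f A s : \bar R :=
  (discrete_content s P (base s) A + c s * \1_A (None : X))%:E.
have f0 A s : (0 <= f A s)%E.
  by rewrite lee_fin addr_ge0 ?discrete_content_ge0// mulr_ge0//.
exists (fun A => ultralim U (f A)); split.
- apply: ultralim_cst; apply: filterS filterT => s _ /=.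
  by rewrite /f discrete_content0 indic0 mulr0 addr0.
- by move=> A; exact: ultralim_ge0.
- move=> A B AB; rewrite -ultralimD//; congr ultralim; apply/funext => s.
  rewrite /f discrete_contentU// -EFinD addrACA -mulrDr; congr ((_ + _ * _)%:E).
  rewrite !indicE in_setU.
  have : ~ (A `&` B) (None : X) by rewrite AB.
  have [|_] := boolP ((None : X) \in A); have [|_] := boolP ((None : X) \in B);
    rewrite ?inE ?addr0 ?add0r//.
  by move=> BN AN; case.
- move=> x; apply: ultralim_cst; apply: FU; exists [:: x] => s xs /=.
  have {}xs : x \in s by apply: xs; rewrite mem_head.
  rewrite /f discrete_content_upset// indicE memNset ?mulr0 ?addr0//.
  by congr (P _)%:E; apply: join_r; exact: meets_inf_seq.
- move=> k Pk; apply: ultralim_cst; apply: filterS filterT => s _ /=.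
  by rewrite /f discrete_contentT indicT mulr1 Pk.
Qed.

End discrete_content.

(** * The spaces obtained by removing the top element *)

Section punctured_theory.
Context {d : Order.disp_t} {K : tLatticeType d}.
Hypothesis domK : is_domain K.
Hypothesis compact_top : way_below (\top%O : K) \top%O.
Let X := with_bot K.
Implicit Types (u v : X) (x y z : K).

Lemma principal_upset_top :
  principal_upset (Some \top%O : X) = [set (Some \top%O : X)].
Proof.
apply/seteqP; split => [[x|] //=|_ ->]; last exact: lexx.
by rewrite /principal_upset /= /Order.le /= le1x => /eqP ->.
Qed.

Lemma way_above_top : way_above \top%O = [set (Some \top%O : X)].
Proof.
apply/seteqP; split => [|_ ->//]; rewrite -principal_upset_top.
exact: way_above_sub.
Qed.

(** Compactness of the top element makes it isolated; removing it therefore leaves a closed, hence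
    compact, space. *)
Lemma open_top : open ([set (Some \top%O)] : set X).
Proof. by rewrite -way_above_top; exact: open_way_above. Qed.

Lemma open_punctured_with_bot : open (punctured_with_bot K).
Proof.
have := @open_not_principal_upset d K (Some \top%O).
by rewrite principal_upset_top.
Qed.

Lemma closed_punctured_with_bot : closed (punctured_with_bot K).
Proof. exact/open_closedC/open_top. Qed.

Lemma punctured_sub : punctured K `<=` punctured_with_bot K.
Proof. by move=> _ [x xt <-] /= [] /xt. Qed.

(** Every element of [K] has some element way below it, whereas the new bottom lies in no
    [way_above z]. *)
Lemma puncturedE :
  punctured K = punctured_with_bot K `&` \bigcup_(z : K) way_above z.
Proof.
apply/seteqP; split => [|[x|] [xt [z _]] //= zx].
  move=> _ [x xt <-]; split; first exact/punctured_sub/imageP.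
  by have [z zx] := exists_way_below domK x; exists z.
by exists x => // xt'; apply: xt; rewrite xt'.
Qed.

Lemma open_punctured : open (punctured K).
Proof.
rewrite puncturedE; apply: openI; first exact: open_punctured_with_bot.
by apply: bigcup_open => z _; exact: open_way_above.
Qed.

(** The open sets [way_above z] cover [C], and meets in [K] give a common lower bound for a finite
    union. *)
Lemma compact_sub_upset (C : set X) : compact C -> C `<=` punctured K ->
  exists z, C `<=` principal_upset (Some z : X).
Proof.
move=> cC CS.
have [|A B [y Ay] [z Bz]|u Cu|U [_ CU [z Uz]]] := @compact_open_ind X C
  (fun W => exists z, W `<=` principal_upset (Some z : X)) cC.
- by exists \top%O.
- exists (y `&` z)%O => u [/Ay|/Bz]; apply: le_trans.
    by rewrite /Order.le /= leIl.
  by rewrite /Order.le /= leIr.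
- have := CS _ Cu; rewrite puncturedE => -[_ [z _ zu]].
  exists (way_above z); split => //; first exact: open_way_above.
  by exists z; exact: way_above_sub.
- by exists z; exact: subset_trans Uz.
Qed.

(** Each point of the compact complement of [U] lies outside [up z] for some [z << x]; directedness
    merges finitely many such [z] into one. *)
Lemma upset_way_below_inside x (U : set X) : open U ->
  principal_upset (Some x : X) `<=` U ->
  exists2 z, way_below z x & principal_upset (Some z : X) `<=` U.
Proof.
move=> oU xU.
have cU : compact (~` U).
  apply: (subclosed_compact _ (lawson_compact domK)) => //.
  exact: open_closedC.
have [|A B [y yx Ay] [z zx Bz]|u Uu|W [_ UW [z zx Wz]]] :=
  @compact_open_ind X (~` U)
  (fun W => exists2 z, way_below z x &
     W `<=` ~` principal_upset (Some z : X)) cU.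
- by have [z zx] := exists_way_below domK x; exists z.
- have [w [wx yw zw]] := way_below_directed domK yx zx.
  exists w => // u ABu wu; case: ABu => [/Ay|/Bz]; apply.
    by apply: le_trans wu.
  by apply: le_trans wu.
- have nxu : ~~ ((Some x : X) <= u)%O by apply/negP => /xU.
  have [z zx nzu] : exists2 z, way_below z x & ~ principal_upset (Some z : X) u.
    have [z [zx nzu]] := not_le_separated domK nxu.
    by exists z.
  exists (~` principal_upset (Some z : X)); split => //.
    exact: open_not_principal_upset.
  by exists z.
- exists z => // u zu; apply: contrapT => /UW /Wz; exact.
Qed.

Section between.
(** Both punctured spaces are instances of [S]; they differ only in the new bottom. *)
Variable S : set X.
Hypothesis pS : punctured K `<=` S.
Hypothesis Sp : S `<=` punctured_with_bot K.

Lemma upset_setI_between x :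
  principal_upset (Some x : X) `&` S =
  principal_upset (Some x : X) `&` punctured_with_bot K.
Proof.
apply/seteqP; split => [u [xu /Sp]//|[y|//] [xy yt]]; split => //.
by apply: pS; exists y => // yt'; apply: yt; rewrite yt'.
Qed.

Lemma compact_upset_setI x : compact (principal_upset (Some x : X) `&` S).
Proof.
rewrite upset_setI_between.
apply: (subclosed_compact _ (lawson_compact domK)) => //.
apply: closedI; first exact: principal_upset_closed.
exact: closed_punctured_with_bot.
Qed.

Lemma upset_setIU_top x : principal_upset (Some x : X) =
  (principal_upset (Some x : X) `&` S) `|` [set (Some \top%O : X)].
Proof.
rewrite upset_setI_between; apply/seteqP; split.
  move=> u xu; have [->|/eqP ut] := eqVneq u (Some \top%O : X); first by right.
  by left.
move=> u [[]//|->]; rewrite /principal_upset /= /Order.le /=; exact: lex1.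
Qed.

End between.

End punctured_theory.

(** * Radon measures on the Lawson topology *)

Section borel_measures.
Context {d : Order.disp_t} {K : tLatticeType d} {R : realType}.
Hypothesis domK : is_domain K.
Let X := with_bot K.
Let upsets : set (set X) := range (@principal_upset d X).
Implicit Types (u v : X) (x y z : K).

Lemma measurable_upset u : measurable (principal_upset u : set (@borelType X)).
Proof. by apply: borel_closed; exact: principal_upset_closed. Qed.

(** The sets admitting such [A] and [W] form a filter, so subbasic sets suffice. The complement of a
    principal upset serves as its own [A] and [W]; a Scott open set around [x] contains some
    [z << x], and [way_above z] and [up z] serve. *)
Lemma upsets_squeeze (U : set X) u : open U -> U u ->
  exists A W, [/\ <<s upsets >> A, open W, W u, W `<=` A & A `<=` U].
Proof.
have [sT sC sB] := smallest_sigma_algebra setT upsets.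
have sI A B : <<s upsets >> A -> <<s upsets >> B -> <<s upsets >> (A `&` B).
  exact: (@measurableI _ (g_sigma_algebraType upsets)).
have sup v : <<s upsets >> (principal_upset v).
  by apply: sub_sigma_algebra; exists v.
have supT : <<s upsets >> setT.
  by have := sup None; rewrite principal_upset_None.
move=> oU Uu.
pose F : set_system X := [set B | exists A W,
  [/\ <<s upsets >> A, open W, W u, W `<=` A & A `<=` B]].
suff : F --> u by apply; exact: open_nbhs_nbhs.
have FF : Filter F.
  split.
  - exists setT, setT; split => //; last exact: openT.
  - move=> A B [A' [A2 [sA oA Au A2A' A'A]]] [B' [B2 [sB' oB Bu B2B' B'B]]].
    exists (A' `&` B'), (A2 `&` B2); split => //.
    + exact: sI.
    + exact: openI.
    + exact: setISS.
    + exact: setISS.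
  - move=> A B AB [A' [A2 [sA oA Au A2A' A'A]]]; exists A', A2; split => //.
    exact: subset_trans AB.
apply: lawson_cvg => V [sV|[v _ <-]] Vu; last first.
  exists (~` principal_upset v), (~` principal_upset v); split => //.
  - by rewrite -setTD; exact: sC.
  - exact: open_not_principal_upset.
(* An upper set containing the new bottom is the whole space. *)
case: u Uu @F FF Vu => [x|] Uu F FF Vu; last first.
  exists setT, setT; split => //.
  - exact: openT.
  - by move=> v _; exact: sV.1 Vu.
pose D : set X := Some @` way_below_set x.
have [dx _ [xub xlub]] := domK.2 x.
have dD : directed D.
  split; first by have [z zx] := dx.1; exists (Some z), z.
  move=> _ _ [y yx <-] [z zx <-]; have [w [wx yw zw]] := dx.2 _ _ yx zx.
  by exists (Some w); split => //; exists w.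
have Dx : supremums D (Some x : X).
  split; first by move=> _ [z /xub zx <-].
  have [z0 z0x] := dx.1.
  move=> [y|] Dy; last by have := Dy (Some z0) (imageP _ z0x).
  by apply: xlub => z zx; exact: (Dy (Some z) (imageP _ zx)).
have [_ [[z zx <-] Vz]] := sV.2 D _ dD Dx Vu.
exists (principal_upset (Some z : X)), (way_above z); split => //.
- exact: open_way_above.
- exact: way_above_sub.
- by move=> v zv; exact: sV.1 zv Vz.
Qed.

(** [J] selects principal upsets of finite mass that are large enough to contain every compact
    subset of [S]. *)
Lemma radon_unique (S J : set X)
    (L M : {measure set (@borelType X) -> \bar R}) :
  open S -> radon_on S L -> radon_on S M ->
  (forall u v, J v -> J (with_bot_join u v)) ->
  (forall C, compact C -> C `<=` S ->
     exists2 v, J v & C `<=` principal_upset v) ->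
  (forall v, J v -> (L (principal_upset v) < +oo)%E) ->
  (forall v, J v -> L (principal_upset v) = M (principal_upset v)) ->
  forall B : set (@borelType X), measurable B -> L B = M B.
Proof.
move=> oS rL rM Jjoin Jcover Lfin LM.
(* Principal upsets form a pi-system, and restricting to [up v] makes the measures finite. *)
have agree v A : J v -> <<s upsets >> A ->
    L (A `&` principal_upset v) = M (A `&` principal_upset v).
  move=> Jv sA.
  apply: (@g_sigma_algebra_measure_unique _ R (@borelType X) upsets _
    (fun=> setT) _ _ (mrestr L (measurable_upset v))
    (mrestr M (measurable_upset v))) => //.
  - by move=> _ [u _ <-]; exact: measurable_upset.
  - by move=> _; exists None => //; exact: principal_upset_None.
  - by rewrite bigcup_const//; exists 0%N.
  - move=> _ _ [u _ <-] [w _ <-]; exists (with_bot_join u w) => //.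
    exact: principal_upset_join.
  - move=> _ [u _ <-]; have := LM _ (Jjoin u v Jv).
    by rewrite principal_upset_join.
  - by move=> _; rewrite /= /mrestr setTI; exact: Lfin.
have sub A : <<s upsets >> A -> measurable (A : set (@borelType X)).
  move: A; apply: smallest_sub; first exact: sigma_algebra_measurable.
  by move=> _ [u _ <-]; exact: measurable_upset.
(* A member of the generated sigma-algebra squeezed between [C] and [U], cut down to some [up v]
   containing [C], compares the two measures. *)
have le_open C (U : set X) : compact C -> C `<=` S -> open U -> C `<=` U ->
    (L C <= M U)%E /\ (M C <= L U)%E.
  move=> cC CS oU CU.
  have [A [sA CA AU]] : exists A, [/\ <<s upsets >> A, C `<=` A & A `<=` U].
    have [|A B [A' [sA AA' AU]] [B' [sB BB' BU]]|x Cx|W [_ CW [A [sA WA AU]]]]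
      :=
      @compact_open_ind X C
        (fun W => exists A, [/\ <<s upsets >> A, W `<=` A & A `<=` U]) cC.
    - by exists set0; split => //; exact: sigma_algebra0.
    - exists (A' `|` B'); split.
      + exact: (@measurableU _ (g_sigma_algebraType upsets)).
      + exact: setUSS.
      + by rewrite subUset.
    - have [A [W [sA oW Wx WA AU]]] := upsets_squeeze oU (CU _ Cx).
      by exists W; split => //; exists A.
    - by exists A; split => //; exact: subset_trans WA.
  have [v Jv Cv] := Jcover _ cC CS.
  have CAv : C `<=` A `&` principal_upset v.
    by move=> x Cx; split; [exact: CA|exact: Cv].
  have mC : measurable (C : set (@borelType X)).
    apply: borel_closed; apply: compact_closed => //.
    exact: lawson_hausdorff.
  have mAv : measurable (A `&` principal_upset v : set (@borelType X)).
    by apply: measurableI; [exact: sub|exact: measurable_upset].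
  have mU := borel_open oU.
  have AvU : A `&` principal_upset v `<=` U by move=> x [/AU].
  split.
    apply: (le_trans (le_borel_measure L mC mAv CAv)).
    by rewrite agree//; exact: le_borel_measure.
  apply: (le_trans (le_borel_measure M mC mAv CAv)).
  by rewrite -agree//; exact: le_borel_measure.
have relopen U : relatively_open S U -> open U.
  by move=> [V oV ->]; exact: openI.
(* Outer regularity gives equality on compact sets, inner regularity then on open sets, and outer
   regularity again on Borel subsets of [S]. *)
have compactE C : compact C -> C `<=` S -> L C = M C.
  move=> cC CS.
  have mC : measurable (C : set (@borelType X)).
    apply: borel_closed; apply: compact_closed => //.
    exact: lawson_hausdorff.
  apply/eqP; rewrite eq_le; apply/andP; split.
    have [_ _ _ ->//] := rM.
    apply: le_ereal_inf_tmp => _ [U [/relopen oU CU] <-].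
    by have [] := le_open _ _ cC CS oU CU.
  have [_ _ _ ->//] := rL; apply: le_ereal_inf_tmp => _ [U [/relopen oU CU] <-].
  by have [] := le_open _ _ cC CS oU CU.
have openE' U : relatively_open S U -> L U = M U.
  move=> rU; have [_ _ -> // _] := rL; have [_ _ -> // _] := rM.
  congr ereal_sup; apply/seteqP; split => _ [C [cC CU] <-]; exists C => //.
    by rewrite compactE//; case: rU CU => V _ -> CU x /CU[].
  by rewrite compactE//; case: rU CU => V _ -> CU x /CU[].
have subE B : measurable (B : set (@borelType X)) -> B `<=` S -> L B = M B.
  move=> mB BS; have [_ _ _ ->//] := rL; have [_ _ _ ->//] := rM.
  congr ereal_inf; apply/seteqP; split => _ [U [rU BU] <-]; exists U => //.
    by rewrite openE'.
  by rewrite openE'.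
move=> B mB; have mS : measurable (S : set (@borelType X)) by exact: borel_open.
rewrite (radon_setI mS mB rL) (radon_setI mS mB rM).
apply: subE; first exact: measurableI.
by move=> x [].
Qed.

End borel_measures.

(** * Exchanging [phi] with [c - phi] *)

Lemma ereal_inf_EFin_imageP (T : Type) (R : realType) (A : set T) (f : T -> R)
    (r : R) :
  r%:E = ereal_inf [set (f z)%:E | z in A] <->
  (forall z, A z -> r <= f z) /\
  (forall e, 0 < e -> exists2 z, A z & f z < r + e).
Proof.
split=> [rE|[lb adh]].
  split=> [z Az|e e0].
    by rewrite -lee_fin rE; apply: ereal_inf_lbound; exists z.
  have fin : ereal_inf [set (f z)%:E | z in A] \is a fin_num by rewrite -rE.
  have [_ [z Az <-]] := lb_ereal_inf_adherent e0 fin.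
  by rewrite -rE -EFinD lte_fin; exists z.
apply/eqP; rewrite eq_le; apply/andP; split.
  by apply: le_ereal_inf_tmp => _ [z Az <-]; rewrite lee_fin lb.
apply/lee_addgt0Pr => e e0; have [z Az fz] := adh e e0.
apply: (@le_trans _ _ (f z)%:E); last by rewrite -EFinD lee_fin ltW.
by apply: ereal_inf_lbound; exists z.
Qed.

(** Turns the Scott condition on [phi] into the conjugate one on [1 - phi]. *)
Lemma ereal_inf_subr (T : Type) (R : realType) (A : set T) (f : T -> R)
    (r c : R) :
  (c - r)%:E = ereal_inf [set (c - f z)%:E | z in A] <->
  r%:E = ereal_sup [set (f z)%:E | z in A].
Proof.
have -> : (r%:E = ereal_sup [set (f z)%:E | z in A]) <->
    ((- r)%:E = ereal_inf [set (- f z)%:E | z in A]).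
  have -> : ereal_sup [set (f z)%:E | z in A] =
      (- ereal_inf [set (- f z)%:E | z in A])%E.
    rewrite -ereal_supN; congr ereal_sup; apply/seteqP.
    split=> [_ [z Az <-]|_ [_ [z Az <-] <-]].
      by exists (- f z)%:E; [exists z|rewrite -EFinN opprK].
    by exists z => //; rewrite -EFinN opprK.
  rewrite EFinN; split => [->|<-]; by rewrite oppeK.
rewrite !ereal_inf_EFin_imageP; split=> -[lb adh]; split.
- by move=> z /lb; rewrite lerD2l.
- by move=> e /adh[z Az fz]; exists z => //; move: fz; rewrite -addrA ltrD2l.
- by move=> z /lb; rewrite lerD2l.
- by move=> e /adh[z Az fz]; exists z => //; rewrite -addrA ltrD2l.
Qed.

Section join_diffs_theory.
Context {d : Order.disp_t} {K : tLatticeType d} {R : realType}.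
Implicit Types (phi : K -> R).

Lemma join_diffsN s phi :
  join_diffs s (fun x => - phi x) = (fun x => - join_diffs s phi x).
Proof.
elim: s phi => //= z s IH phi; rewrite -IH; congr join_diffs.
by apply/funext => x; rewrite /join_diff opprB opprK addrC.
Qed.

(** The first difference kills the constant, whence the condition that [s] be nonempty. *)
Lemma join_diffs_subr s phi c : s != [::] ->
  join_diffs s (fun x => c - phi x) = (fun x => - join_diffs s phi x).
Proof.
case: s => //= z s _; rewrite -join_diffsN; congr join_diffs.
by apply/funext => x; rewrite /join_diff; rewrite !opprB addrC addrA subrK.
Qed.

Lemma completely_join_monotone_subr phi c :
  completely_join_monotone (fun x => c - phi x) <->
  completely_join_alternating phi.
Proof.
split=> -[mono diffs]; split.
- by move=> x y /mono; rewrite lerD2l lerN2.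
- by move=> s s0 x; have := diffs s s0 x; rewrite join_diffs_subr// oppr_ge0.
- by move=> x y /mono; rewrite lerD2l lerN2.
- by move=> s s0 x; rewrite join_diffs_subr// oppr_ge0; exact: diffs.
Qed.

End join_diffs_theory.

(** * Conjugate Scott functions and Radon measures on either punctured space *)

Section representation.
Context {d : Order.disp_t} {K : tLatticeType d} {R : realType}.
Hypothesis domK : is_domain K.
Hypothesis compact_top : way_below (\top%O : K) \top%O.
Let X := with_bot K.
Implicit Types (u v : X) (x y z : K) (Phi : K -> R)
  (L : {measure set (@borelType X) -> \bar R}).

Variable S : set X.
Hypothesis pS : punctured K `<=` S.
Hypothesis Sp : S `<=` punctured_with_bot K.
Hypothesis oS : open S.

(** A difference along [z] replaces [A] by [A \ up z], so iterated differences remain measures of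
    sets. *)
Lemma measure_join_diffs L (A : set X) (psi : K -> R) s x :
  measurable (A : set (@borelType X)) ->
  (forall y, (psi y)%:E = L (principal_upset (Some y : X) `&` A)) ->
  0 <= join_diffs s psi x.
Proof.
elim: s A psi => [|z s IH] A psi mA psiE /=; first by rewrite -lee_fin psiE.
apply: (IH (A `\` principal_upset (Some z : X))).
  by apply: measurableD => //; exact: measurable_upset.
move=> y.
have mY : measurable (principal_upset (Some y : X) `&` A : set (@borelType X)).
  by apply: measurableI => //; exact: measurable_upset.
have zE : L (principal_upset (Some y : X) `&` A `&`
    principal_upset (Some z : X)) = (psi (y `|` z)%O)%:E.
  by rewrite psiE setIAC -principal_upset_join.
have zfin : L (principal_upset (Some y : X) `&` A `&`
    principal_upset (Some z : X)) \is a fin_num by rewrite zE.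
rewrite /join_diff EFinB psiE -zE.
rewrite (measureDI L mY (@measurable_upset d K (Some z))).
rewrite addeK; last exact: zfin.
by congr (L _); apply/esym; exact: setIDA.
Qed.

Lemma conjugate_scott_of_radon L Phi :
  Phi \top%O = 0 -> (forall x, 0 <= Phi x) ->
  radon_on S L ->
  (forall x, (Phi x)%:E = L (principal_upset (Some x : X) `&` S)) ->
  conjugate_scott_function Phi /\ completely_join_monotone Phi.
Proof.
move=> Phi1 Phi0 rL PhiE.
have mS : measurable (S : set (@borelType X)) by exact: borel_open.
have mU x :
    measurable (principal_upset (Some x : X) `&` S : set (@borelType X)).
  by apply: measurableI => //; exact: measurable_upset.
have mono : {homo Phi : x y / (x <= y)%O >-> y <= x}.
  move=> x y xy; rewrite -lee_fin !PhiE; apply: le_borel_measure => //.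
  by apply: setSI => u; exact: le_trans.
split; split => //; last by move=> s _ x; exact: measure_join_diffs mS PhiE.
move=> x; apply/eqP; rewrite eq_le; apply/andP; split.
  apply: le_ereal_inf_tmp => _ [z zx <-]; rewrite lee_fin; apply: mono.
  exact: way_belowW.
have [_ _ _ rE] := rL; rewrite PhiE rE//.
apply: le_ereal_inf_tmp => _ [U [rU xU] <-].
have [V oV UV] := rU.
(* Outer regularity bounds only the part of [up x] in [S]. Adding the isolated top yields an open
   set containing all of [up x], hence some [up z] with [z << x]; the top is then discarded, as it
   is not in [S]. *)
have [|u xu|z zx zV] :=
  @upset_way_below_inside d K domK x (V `|` [set (Some \top%O : X)]).
- by apply: openU => //; exact: open_top.
- move: xu; rewrite (upset_setIU_top pS Sp) => -[/xU|]; last by right.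
  by rewrite UV => -[_]; left.
apply: (@le_trans _ _ (Phi z)%:E); first by apply: ereal_inf_lbound; exists z.
rewrite PhiE; apply: le_borel_measure => //.
  by rewrite UV; apply: measurableI => //; exact: borel_open.
move=> u [/zV + Su]; rewrite UV => -[Vu|ut]; first by split.
by exfalso; exact: Sp Su ut.
Qed.

(** Compactness of [up x] within [S] gives [Phi x] as a lower bound. For [z << x], the open set
    [way_above z] between [up x] and [up z] gives the upper bound [Phi z], and the infimum over [z]
    is [Phi x]. *)
Lemma radon_of_conjugate_scott Phi (m : set X -> \bar R) :
  conjugate_scott_function Phi ->
  m set0 = 0%E -> (forall A, 0 <= m A)%E ->
  (forall A B, A `&` B = set0 -> m (A `|` B) = (m A + m B)%E) ->
  (forall x, m (principal_upset (Some x : X)) = (Phi x)%:E) ->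
  (forall u, S u -> exists W, [/\ open W, W u & (m W < +oo)%E]) ->
  exists L, [/\ radon_on S L,
    forall x, (Phi x)%:E = L (principal_upset (Some x : X) `&` S)
    & S = punctured_with_bot K -> L S = m setT].
Proof.
move=> [Phi0 Phi1 Phiinf] m0 m_ge0 mU mE mloc.
have [L [rL mL Lm]] :=
  radon_of_content (lawson_hausdorff domK) (lawson_compact domK) oS
    m0 m_ge0 mU mloc.
have le_m A B : A `<=` B -> (m A <= m B)%E.
  by move=> AB; rewrite -(setDUK AB) mU ?leeDl// setDIK.
(* The top carries no mass, so removing it from [up x] or from the whole space changes nothing. *)
have mtop : m [set (Some \top%O : X)] = 0%E.
  by rewrite -principal_upset_top mE Phi1.
have mS : measurable (S : set (@borelType X)) by exact: borel_open.
exists L; split => //.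
  move=> x; apply/eqP; rewrite eq_le; apply/andP; split.
    rewrite -mE [in leLHS](upset_setIU_top pS Sp) mU; last first.
      by rewrite -subset0 => u [[_ /Sp Su] ut]; exact: Su.
    rewrite mtop adde0; apply: mL => //.
    exact: (compact_upset_setI domK compact_top pS Sp).
  rewrite Phiinf; apply: le_ereal_inf_tmp => _ [z zx <-].
  rewrite -mE; apply: (@le_trans _ _ (m (way_above z))); last first.
    exact/le_m/way_above_sub.
  apply: (@le_trans _ _ (L (way_above z))); last exact/Lm/open_way_above.
  apply: le_borel_measure.
  - by apply: measurableI => //; exact: measurable_upset.
  - by apply: borel_open; exact: open_way_above.
  - by move=> u [xu _]; exact: (way_above_scott_open domK z).1 xu zx.
(* Here [S] is both open and compact, so both comparisons of [L] with [m] apply to it. *)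
move=> SE; have mST : m setT = m S.
  rewrite -(setvU S) mU; last by rewrite setICl.
  rewrite [X in m (~` X)]SE setCK mtop add0e //.
apply/eqP; rewrite eq_le mST Lm//= mL// SE.
apply: (subclosed_compact _ (lawson_compact domK)) => //.
exact: closed_punctured_with_bot.
Qed.

End representation.

(** * Existence and uniqueness on the two punctured spaces *)

Section main_theorem.
Context {R : realType} {d : Order.disp_t} {K : tLatticeType d}.
Hypothesis domK : is_domain K.
Hypothesis compact_top : way_below (\top%O : K) \top%O.
Let X := with_bot K.
Implicit Types (x y z : K) (phi Phi : K -> R)
  (L : {measure set (@borelType X) -> \bar R}).

Lemma locally_compact_representation Phi :
  (forall x, 0 <= Phi x) -> Phi \top%O = 0 ->
  exists_unique_radon_on (punctured K)
    (fun L => forall x,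
       (Phi x)%:E = L (principal_upset (Some x : X) `&` punctured K))
  <-> conjugate_scott_function Phi /\ completely_join_monotone Phi.
Proof.
move=> Phi0 Phi1; set S := punctured K.
have oS : open S by exact: open_punctured.
have mS : measurable (S : set (@borelType X)) by exact: borel_open.
have pS : punctured K `<=` S by [].
have Sp : S `<=` punctured_with_bot K by exact: punctured_sub.
split.
  move=> [L [rL PhiL _]].
  by have := conjugate_scott_of_radon domK compact_top pS Sp oS Phi1 Phi0 rL
    PhiL.
move=> [cPhi [mono diffs]].
have diffs0 t y : 0 <= join_diffs t Phi y.
  by case: t => [|z t]; [exact: Phi0|exact: diffs].
(* The constant 0 puts no mass at the new bottom. *)
have [m [m0 m_ge0 mU mE _]] := exists_content diffs0 (fun=> lexx (0 : R)).
have [u Su|L [rL PhiL _]] :=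
  radon_of_conjugate_scott domK compact_top pS Sp oS cPhi m0 m_ge0 mU mE.
  (* Local finiteness: [way_above z] is an open neighbourhood of [u] inside [up z], whose mass is
     [Phi z]. *)
  have [_ [z _ zu]] : (punctured_with_bot K `&` \bigcup_(z : K) way_above z) u.
    by rewrite -puncturedE.
  exists (way_above z); split => //; first exact: open_way_above.
  apply: (@le_lt_trans _ _ (m (principal_upset (Some z : X)))); last first.
    by rewrite mE ltry.
  by rewrite -(setDUK (@way_above_sub d K z)) mU ?leeDl// setDIK.
exists L; split => // M rM PhiM B mB.
(* [J] omits the new bottom, since its upset is the whole space and may have infinite mass. *)
apply: (radon_unique domK (J := [set v : X | v <> None]) oS rM rL) => //.
- by move=> [x|] [y|].
- by move=> C cC /(compact_sub_upset domK cC)[z Cz]; exists (Some z).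
- move=> [x|//] _; rewrite (radon_setI mS (measurable_upset _) rM).
  by rewrite -PhiM ltry.
- move=> [x|//] _; rewrite (radon_setI mS (measurable_upset _) rM).
  by rewrite (radon_setI mS (measurable_upset _) rL) -PhiM -PhiL.
Qed.

Lemma compact_representation phi : (forall x, 0 <= phi x) -> phi \top%O = 1 ->
  exists_unique_radon_on (punctured_with_bot K)
    (fun L => forall x, (phi x)%:E = L (~` principal_upset (Some x : X)))
  <-> scott_function phi /\ completely_join_alternating phi.
Proof.
move=> phi0 phi1; set S := punctured_with_bot K.
pose Phi x := 1 - phi x.
have Phi1 : Phi \top%O = 0 by rewrite /Phi phi1 subrr.
have oS : open S by exact: open_punctured_with_bot.
have mS : measurable (S : set (@borelType X)) by exact: borel_open.
have pS : punctured K `<=` S by exact: punctured_sub.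
have Sp : S `<=` punctured_with_bot K by [].
have mup x : measurable (principal_upset (Some x : X) : set (@borelType X)).
  exact: measurable_upset.
(* At the top element, the complement of the principal upset is [S] itself. *)
have massE L : radon_on S L ->
    (forall x, (phi x)%:E = L (~` principal_upset (Some x : X))) -> L S = 1%E.
  by move=> rL /(_ \top%O); rewrite phi1 principal_upset_top.
(* With total mass 1, the masses of [up x] and of its complement determine each other. *)
have complE L : radon_on S L -> L S = 1%E ->
    (forall x, (phi x)%:E = L (~` principal_upset (Some x : X))) <->
    (forall x, (Phi x)%:E = L (principal_upset (Some x : X) `&` S)).
  move=> rL LS.
  suff H x : (phi x)%:E = L (~` principal_upset (Some x : X)) <->
             (Phi x)%:E = L (principal_upset (Some x : X) `&` S).
    by split => LE x; apply/H.
  have mC : measurable (~` principal_upset (Some x : X) : set (@borelType X)).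
    exact: measurableC.
  have : L S = (L (~` principal_upset (Some x : X)) +
                L (principal_upset (Some x : X) `&` S))%E.
    rewrite (measureDI L mS (mup x)) (radon_setI mS mC rL).
    by congr (L _ + L _)%E; rewrite ?setDE setIC.
  rewrite LS => /esym sum1; split => eq.
    by rewrite EFinB -sum1 -eq addeAC subee// add0e.
  have -> : (phi x)%:E = (1 - (Phi x)%:E)%E by rewrite -EFinB subKr.
  by rewrite -sum1 -eq addeK.
split.
  move=> [L [rL phiL _]]; have LS := massE L rL phiL.
  have PhiL := (complE L rL LS).1 phiL.
  have Phi0 x : 0 <= Phi x by rewrite -lee_fin PhiL.
  have [cPhi mPhi] :=
    conjugate_scott_of_radon domK compact_top pS Sp oS Phi1 Phi0 rL PhiL.
  split; last exact: (completely_join_monotone_subr phi 1).1 mPhi.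
  by split => // x; apply/ereal_inf_subr; case: cPhi => _ _; exact.
move=> [[_ _ supphi] aphi].
have [mono _] := aphi.
have Phi0 x : 0 <= Phi x by rewrite subr_ge0 -phi1; exact/mono/lex1.
have cPhi : conjugate_scott_function Phi by split => // x; exact/ereal_inf_subr.
have [_ diffs] := (completely_join_monotone_subr phi 1).2 aphi.
have diffs0 t y : 0 <= join_diffs t Phi y.
  by case: t => [|z t]; [exact: Phi0|exact: diffs].
(* The discrete content of [Phi] based at the meet of [s] has total mass 1 minus [phi] of that meet;
   the missing amount goes to the new bottom. *)
have [m [m0 m_ge0 mU mE mT]] :=
  exists_content diffs0 (fun s => phi0 (\meet_(z <- s) z)%O).
have mT1 : m setT = 1%E by apply: mT => s; rewrite subrK.
have [u _|L [rL PhiL LS]] :=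
  radon_of_conjugate_scott domK compact_top pS Sp oS cPhi m0 m_ge0 mU mE.
  by exists setT; split => //; [exact: openT|rewrite mT1 ltry].
have {}LS : L S = 1%E by rewrite LS.
have phiL := (complE L rL LS).2 PhiL.
exists L; split => // M rM phiM B mB.
have MS := massE M rM phiM; have PhiM := (complE M rM MS).1 phiM.
(* The measures have total mass 1, so [J] may include the new bottom, whose upset contains every
   compact set. *)
apply: (radon_unique domK (J := setT) oS rM rL) => //.
- by move=> C _ _; exists None => //; rewrite principal_upset_None.
- move=> [x|] _; rewrite (radon_setI mS (measurable_upset _) rM).
    by rewrite -PhiM ltry.
  by rewrite principal_upset_None setTI MS ltry.
- move=> [x|] _; rewrite (radon_setI mS (measurable_upset _) rM).
    by rewrite (radon_setI mS (measurable_upset _) rL) -PhiM -PhiL.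
  rewrite (radon_setI mS (measurable_upset _) rL).
  by rewrite principal_upset_None setTI MS LS.
Qed.

End main_theorem.

Theorem theorem6p6 (R : realType) (d : Order.disp_t) (K : tLatticeType d)
  (domK : is_domain K)
  (compact_top : way_below (\top%O : K) \top%O)
  (multK : way_below_multiplicative K) :
  (forall phi : K -> R, (forall x, 0 <= phi x) -> phi \top%O = 1 ->
    (exists_unique_radon_on (punctured_with_bot K)
       (fun L : {measure set (@borelType (with_bot K)) -> \bar R} =>
          forall x : K,
            (phi x)%:E = L (~` principal_upset (with_bot_incl x)))
     <-> scott_function phi /\ completely_join_alternating phi))
  /\
  (forall Phi : K -> R, (forall x, 0 <= Phi x) -> Phi \top%O = 0 ->
    (exists_unique_radon_on (punctured K)
       (fun L : {measure set (@borelType (with_bot K)) -> \bar R} =>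
          forall x : K,
            (Phi x)%:E =
              L (principal_upset (with_bot_incl x) `&` punctured K))
     <-> conjugate_scott_function Phi /\ completely_join_monotone Phi)).
Proof.
by split=> [phi phi0 phi1|Phi Phi0 Phi1];
  [exact: compact_representation|exact: locally_compact_representation].
Qed.
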